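(* The triadic kagome mesh $\mathcal{M}_{\rm kag}$ is rigid with respect to uniformly $C_1$-smooth flexes; that is, for every uniformly $C_1$-smooth flex $(p_t)_{t\in[0,1]}$ of $\mathcal{M}_{\rm kag}$, each placement $p_t$ is the restriction to $|\mathcal{M}_{\rm kag}|$ of an isometry of $\mathbb{R}^2$.
   Context: A linear string-node net in $\mathbb{R}^2$ consists of a countable set of lines (strings) together with their set of intersection points (nodes); its body is the union of its strings. $\mathcal{N}_{\rm kag}$ is the linear net of the kagome tiling by regular triangles and hexagons, in standard position: its strings are the horizontal lines $y=k\sqrt3$ ($k\in\mathbb{Z}$), the lines of slope $\sqrt3$ meeting the $x$-axis at even integers, and the lines of slope $-\sqrt3$ meeting the $x$-axis at odd integers. The triadic kagome mesh $\mathcal{M}_{\rm kag}$ is the linear mesh whose body is $$|\mathcal{M}_{\rm kag}|=\bigcup_{n=1}^\infty\frac1{3^n}|\mathcal{N}_{\rm kag}|,$$ with strings the lines in this union and nodes their intersection points. For a mesh $\mathcal{M}$ in $\mathbb{R}^d$ with line (or line segment) strings and body $|\mathcal{M}|$: a $C_k$-smooth placement of $\mathcal{M}$ is an injective map $p:|\mathcal{M}|\to\mathbb{R}^d$ whose restriction to each string is $C_k$-smooth and length preserving (the length of the image path of each subsegment of a string equals the length of the subsegment). A $C_k$-smooth flex of $\mathcal{M}$ is a pointwise continuous path $t\mapsto p_t$, $t\in[0,1]$, of $C_k$-smooth placements, starting at the identity placement $p_0$. It is uniformly $C_k$-smooth if the associated map $(x,t)\mapsto p_t(x)$ from $|\mathcal{M}|\times[0,1]$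 to $\mathbb{R}^d$ is (after extension by continuity) a $k$-fold continuously differentiable function on $(|\mathcal{M}|^-)^{o}\times[0,1]$, where $(|\mathcal{M}|^-)^{o}$ is the interior of the closure of $|\mathcal{M}|$ (here all of $\mathbb{R}^2$). *)

(* Defs.v *)
From HB Require Import structures.
From mathcomp Require Export all_boot all_order all_algebra.
From mathcomp Require Export all_classical all_reals all_analysis.
From mathcomp Require Import ring.
Export Order.TTheory GRing.Theory Num.Theory.
Export numFieldNormedType.Exports.

Set Implicit Arguments.
Unset Strict Implicit.
Unset Printing Implicit Defensive.

Local Open Scope classical_set_scope.
Local Open Scope ring_scope.

(* The library norm [`|_|] on ['rV_d] is the sup norm: it induces the usual
   topology and the usual notion of differentiability, but lengths and
   isometries have to be measured with the Euclidean norm. *)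
Definition enorm (R : realType) (d : nat) (x : 'rV[R]_d) : R :=
  Num.sqrt (\sum_i x 0 i ^+ 2).

Definition euclidean_isometry (R : realType) (d : nat)
    (T : 'rV[R]_d -> 'rV[R]_d) : Prop :=
  forall x y, enorm (T x - T y) = enorm (x - y).

(* Affine parametrization of the line through [x] and [y], with [x] at time 0
   and [y] at time 1; it is constant if [x = y]. *)
Definition chord (R : realType) (d : nat) (x y : 'rV[R]_d) (s : R) : 'rV[R]_d :=
  x + s *: (y - x).

Definition is_line (R : realType) (d : nat) (L : set 'rV[R]_d) : Prop :=
  exists x y : 'rV[R]_d, x != y /\ L = range (chord x y).

(* The counterpart of the library's [variation] and [total_variation] for
   curves: [s] lists the points of a subdivision of [[a, b]] other than [a]. *)
Definition polygonal_length (R : realType) (d : nat) (a b : R)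
    (g : R -> 'rV[R]_d) (s : seq R) : R :=
  \sum_(0 <= n < size s) enorm (g (nth b s n) - g (nth b (a :: s) n)).

Definition path_length (R : realType) (d : nat) (a b : R)
    (g : R -> 'rV[R]_d) : \bar R :=
  ereal_sup [set (polygonal_length a b g s)%:E | s in itv_partition a b].

(* [f] is continuously differentiable on [A], with the Frechet derivative taken
   relative to [A]; this is meant for sets such as [U `*` `[0, 1]] with [U]
   open, which are not open but where this derivative is unique. The spaces are
   meant to be finite-dimensional: then every linear map is continuous, and
   pointwise continuity of the derivative is continuity in operator norm. *)
Definition C1_on (R : realType) (V W : normedModType R) (A : set V)
    (f : V -> W) : Prop :=
  exists df : V -> {linear V -> W},
    (forall a, A a ->
       forall z, f z = f a + df a (z - a)
                 +o_(z \near within A (nbhs a)) (z - a)) /\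
    (forall v, {within A, continuous (fun a => df a v)}).

(* The nodes are the intersection points of the strings, so that the set of
   strings determines the mesh. *)
Record linear_mesh (R : realType) (d : nat) := LinearMesh {
  strings : set (set 'rV[R]_d) ;
  strings_countable : countable strings ;
  strings_line : forall L, strings L -> is_line L }.

Definition nodes (R : realType) (d : nat) (M : linear_mesh R d) :
    set 'rV[R]_d :=
  [set x | exists L L', [/\ strings M L, strings M L', L <> L', L x & L' x]].

Definition body (R : realType) (d : nat) (M : linear_mesh R d) :
    set 'rV[R]_d :=
  \bigcup_(L in strings M) L.

(* Placements are total functions of which only the values on the body matter.
   A string is a line, so for [x <> y] on it the map [p \o chord x y] is the
   restriction of [p] to the whole string, in an affine parameter. *)
Definition C1_on_string (R : realType) (d : nat) (p : 'rV[R]_d -> 'rV[R]_d)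
    (L : set 'rV[R]_d) : Prop :=
  forall x y, L x -> L y ->
    (forall s : R, derivable (p \o chord x y) s 1) /\
    continuous (derive1 (p \o chord x y)).

Definition length_preserving_on (R : realType) (d : nat)
    (p : 'rV[R]_d -> 'rV[R]_d) (L : set 'rV[R]_d) : Prop :=
  forall x y, L x -> L y ->
    path_length 0 1 (p \o chord x y) = (enorm (y - x))%:E.

Definition C1_placement (R : realType) (d : nat) (M : linear_mesh R d)
    (p : 'rV[R]_d -> 'rV[R]_d) : Prop :=
  [/\ {in body M &, injective p},
      forall L, strings M L -> C1_on_string p L
    & forall L, strings M L -> length_preserving_on p L].

Definition C1_flex (R : realType) (d : nat) (M : linear_mesh R d)
    (p : R -> 'rV[R]_d -> 'rV[R]_d) : Prop :=
  [/\ forall t : R, t \in `[0, 1] -> C1_placement M (p t),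
      forall x, body M x -> {within `[0, 1], continuous (fun t => p t x)}
    & forall x, body M x -> p 0 x = x].

(* [P] is the extension by continuity of [(x, t) |-> p t x]; its values outside
   the closure of the body are irrelevant. *)
Definition uniformly_C1_flex (R : realType) (d : nat) (M : linear_mesh R d)
    (p : R -> 'rV[R]_d -> 'rV[R]_d) : Prop :=
  C1_flex M p /\
  exists P : 'rV[R]_d * R -> 'rV[R]_d,
    (forall x (t : R), body M x -> t \in `[0, 1] -> P (x, t) = p t x) /\
    C1_on ((closure (body M))° `*` `[0 : R, 1 : R]) P.

Definition kagome_horizontal (R : realType) (k : int) : set 'rV[R]_2 :=
  [set x | x 0 1 = k%:~R * Num.sqrt 3].

Definition kagome_up (R : realType) (k : int) : set 'rV[R]_2 :=
  [set x | x 0 1 = Num.sqrt 3 * (x 0 0 - (2 * k)%:~R)].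

Definition kagome_down (R : realType) (k : int) : set 'rV[R]_2 :=
  [set x | x 0 1 = - Num.sqrt 3 * (x 0 0 - (2 * k + 1)%:~R)].

Definition kagome_strings (R : realType) : set (set 'rV[R]_2) :=
  range (@kagome_horizontal R) `|` range (@kagome_up R)
  `|` range (@kagome_down R).

Lemma kagome_strings_countable (R : realType) : countable (@kagome_strings R).
Proof.
have rangeC (f : int -> set 'rV[R]_2) : countable (range f).
  exact: (card_le_trans (card_image_le _ _) (countableP _)).
have countableU2 (A B : set (set 'rV[R]_2)) :
    countable A -> countable B -> countable (A `|` B).
  move=> Ac Bc; rewrite -bigcup2E; apply: bigcup_countable => //.
  by move=> [|[|n]] _ //=; exact: countable0.
by apply: (countableU2 _ _ (countableU2 _ _ _ _)); exact: (rangeC _).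
Qed.

Lemma graph_is_line (R : realType) (m q : R) :
  is_line [set x : 'rV[R]_2 | x 0 1 = m * x 0 0 + q].
Proof.
pose pt (u : R) : 'rV[R]_2 := \row_j (if j == 0 then u else m * u + q).
exists (pt 0), (pt 1); split.
  apply/eqP => /rowP /(_ 0); rewrite !mxE /= => /eqP.
  by rewrite eq_sym oner_eq0.
apply/seteqP; split => [x /= xE|_ [s _ <-]]; last by rewrite /= !mxE /=; ring.
exists (x 0 0) => //; apply/rowP => j; rewrite !mxE.
have [->|->] : j = 0 \/ j = 1.
- by case: j => [[|[|//]] ?]; [left|right]; exact/val_inj.
- by rewrite /=; ring.
- by rewrite /= xE; ring.
Qed.

Lemma kagome_strings_line (R : realType) (L : set 'rV[R]_2) :
  kagome_strings L -> is_line L.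
Proof.
have H m q (S : set 'rV[R]_2) :
    (forall x, S x <-> x 0 1 = m * x 0 0 + q) -> is_line S.
  move=> SE; suff -> : S = [set x | x 0 1 = m * x 0 0 + q].
    exact: graph_is_line.
  by apply/seteqP; split => x /SE.
case=> [[]|] [k _ <-].
- by apply: (H 0 (k%:~R * Num.sqrt 3)) => x; rewrite mul0r add0r.
- apply: (H (Num.sqrt 3) (- Num.sqrt 3 * (2 * k)%:~R)) => x.
  by rewrite /kagome_up /= mulrBr mulNr.
- apply: (H (- Num.sqrt 3) (Num.sqrt 3 * (2 * k + 1)%:~R)) => x.
  by rewrite /kagome_down /= mulrBr !mulNr opprK.
Qed.

Definition kagome_net (R : realType) : linear_mesh R 2 :=
  LinearMesh (@kagome_strings_countable R) (@kagome_strings_line R).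

Definition triadic_kagome_strings (R : realType) : set (set 'rV[R]_2) :=
  \bigcup_(n in [set n | (1 <= n)%N])
    [set [set 3 ^- n *: x | x in L] | L in strings (kagome_net R)].

Lemma triadic_kagome_strings_countable (R : realType) :
  countable (@triadic_kagome_strings R).
Proof.
apply: bigcup_countable => // n _.
exact: (card_le_trans (card_image_le _ _) (strings_countable _)).
Qed.

Lemma triadic_kagome_strings_line (R : realType) (L : set 'rV[R]_2) :
  triadic_kagome_strings L -> is_line L.
Proof.
case=> n _ [L' /strings_line [x [y [xy ->]]] <-].
exists (3 ^- n *: x), (3 ^- n *: y); split.
  apply: contra_neq xy; apply: scalerI.
  by rewrite invr_eq0 expf_neq0 // pnatr_eq0.
have chordZ s : 3 ^- n *: chord x y s = chord (3 ^- n *: x) (3 ^- n *: y) s.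
  by rewrite /chord scalerDr -scalerBr !scalerA mulrC.
apply/seteqP; split => [_ [_ [s _ <-] <-]|_ [s _ <-]].
  by exists s => //; rewrite chordZ.
by exists (chord x y s); [exists s|rewrite chordZ].
Qed.

Definition triadic_kagome_mesh (R : realType) : linear_mesh R 2 :=
  LinearMesh (@triadic_kagome_strings_countable R)
    (@triadic_kagome_strings_line R).

Lemma body_triadic_kagome_mesh (R : realType) :
  body (triadic_kagome_mesh R) =
  \bigcup_(n in [set n | (1 <= n)%N]) [set 3 ^- n *: x | x in body (kagome_net R)].
Proof.
apply/seteqP; split.
- move=> x [_ [n n1 [L LN <-]] [y Ly <-]].
  by exists n => //; exists y => //; exists L.
- move=> _ [n n1 [y [L LN Ly] <-]].
  by exists [set 3 ^- n *: x | x in L]; [exists n => //; exists L|exists y].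
Qed.

(* Main.v *)
Require Import Defs.
From HB Require Import structures.
From mathcomp Require Import ring lra.
Set Implicit Arguments.
Unset Strict Implicit.
Unset Printing Implicit Defensive.
Local Open Scope classical_set_scope.
Local Open Scope ring_scope.

(* Fix t. Along a string, length preservation forces the C1 extension of p_t to
   have a unit directional derivative. The strings in each of the three
   directions of the kagome net are dense, so by continuity the derivative is
   isometric on three directions at every point of the plane, and a quadratic
   form on the plane is determined by its values on three directions: the
   derivative is orthogonal everywhere. Hence each coordinate u of the extension
   is an entire solution of the eikonal equation |grad u| = 1. Such a u is affine:
   it is 1-Lipschitz, it grows at unit speed along the whole line through x
   directed by grad u(x), and a 1-Lipschitz function doing so on one line is
   determined. This replaces the inverse function theorem in the argument that
   a map with orthogonal derivative is an isometry. *)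

(** * The Euclidean norm and its inner product, compared with the sup norm *)

Section EuclideanNorm.
Context {R : realType} {d : nat}.
Implicit Types (x y z : 'rV[R]_d) (a : R).

Definition dotp x y : R := \sum_i x 0 i * y 0 i.

Lemma dotpC x y : dotp x y = dotp y x.
Proof. by apply: eq_bigr => i _; rewrite mulrC. Qed.

Lemma dotpDl x y z : dotp (x + y) z = dotp x z + dotp y z.
Proof. by rewrite -big_split; apply: eq_bigr => i _; rewrite mxE mulrDl. Qed.

Lemma dotpZl a x y : dotp (a *: x) y = a * dotp x y.
Proof. by rewrite [RHS]mulr_sumr; apply: eq_bigr => i _; rewrite mxE mulrA. Qed.

Lemma dotpNl x y : dotp (- x) y = - dotp x y.
Proof. by rewrite -scaleN1r dotpZl mulN1r. Qed.

Lemma dotpDr x y z : dotp x (y + z) = dotp x y + dotp x z.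
Proof. by rewrite !(dotpC x) dotpDl. Qed.

Lemma dotpZr a x y : dotp x (a *: y) = a * dotp x y.
Proof. by rewrite !(dotpC x) dotpZl. Qed.

Lemma dotpNr x y : dotp x (- y) = - dotp x y.
Proof. by rewrite !(dotpC x) dotpNl. Qed.

Lemma dotp0l y : dotp 0 y = 0.
Proof. by rewrite -(scale0r 0) dotpZl mul0r. Qed.

Definition dotpE := (dotpDl, dotpDr, dotpZl, dotpZr, dotpNl, dotpNr).

Lemma dotpxx_ge0 x : 0 <= dotp x x.
Proof. by apply: sumr_ge0 => i _; rewrite -expr2 sqr_ge0. Qed.

Lemma enormE x : enorm x = Num.sqrt (dotp x x).
Proof. by []. Qed.

Lemma sqr_enorm x : enorm x ^+ 2 = dotp x x.
Proof. by rewrite enormE sqr_sqrtr // dotpxx_ge0. Qed.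

Lemma enorm_ge0 x : 0 <= enorm x.
Proof. exact: sqrtr_ge0. Qed.

Lemma enorm0 : enorm (0 : 'rV[R]_d) = 0.
Proof. by rewrite enormE dotp0l sqrtr0. Qed.

Lemma enormZ a x : enorm (a *: x) = `|a| * enorm x.
Proof.
by rewrite !enormE !dotpE mulrA -expr2 sqrtrM ?sqr_ge0 // sqrtr_sqr.
Qed.

Lemma enormN x : enorm (- x) = enorm x.
Proof. by rewrite !enormE !dotpE opprK. Qed.

Lemma enormB x y : enorm (x - y) = enorm (y - x).
Proof. by rewrite -enormN opprB. Qed.

Lemma norm_coord_le_enorm x i : `|x 0 i| <= enorm x.
Proof.
rewrite enormE -sqrtr_sqr ler_sqrt ?dotpxx_ge0 // /dotp (bigD1 i) //= -expr2.
by rewrite lerDl sumr_ge0 // => j _; rewrite -expr2 sqr_ge0.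
Qed.

Lemma norm_le_enorm x : `|x| <= enorm x.
Proof.
rewrite /Num.norm /= mx_normrE; apply/bigmax_leP; split=> [|[i j] _] /=.
  exact: enorm_ge0.
by rewrite (ord1 i) norm_coord_le_enorm.
Qed.

Lemma enorm_eq0 x : enorm x = 0 -> x = 0.
Proof.
by move=> x0; apply/eqP; rewrite -normr_le0 (le_trans (norm_le_enorm _)) ?x0.
Qed.

(** Cauchy-Schwarz: the squared norm of [enorm y *: x - enorm x *: y] is [2 * enorm x * enorm y]
    times the difference of the two sides. *)
Lemma dotp_le x y : dotp x y <= enorm x * enorm y.
Proof.
have [/enorm_eq0 ->|x0] := eqVneq (enorm x) 0.
  by rewrite dotp0l enorm0 mul0r.
have [/enorm_eq0 ->|y0] := eqVneq (enorm y) 0.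
  by rewrite dotpC dotp0l enorm0 mulr0.
have := dotpxx_ge0 (enorm y *: x - enorm x *: y).
rewrite !dotpE -!sqr_enorm (dotpC y x).
have xy0 : 0 < enorm x * enorm y by rewrite mulr_gt0 // lt0r ?x0 ?y0 enorm_ge0.
move=> h; rewrite -subr_ge0 -(pmulr_lge0 _ xy0); lra.
Qed.

Lemma norm_dotp_le x y : `|dotp x y| <= enorm x * enorm y.
Proof. by rewrite ler_norml dotp_le lerNl -dotpNl -(enormN x) dotp_le. Qed.

Lemma ler_enormD x y : enorm (x + y) <= enorm x + enorm y.
Proof.
rewrite -ler_sqr ?nnegrE ?addr_ge0 ?enorm_ge0 // sqr_enorm !dotpE (dotpC y x).
by rewrite -!sqr_enorm; have := dotp_le x y; lra.
Qed.

Lemma enorm_continuous : continuous (@enorm R d).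
Proof.
move=> x; apply: (@continuous_comp _ _ _ (fun y => dotp y y) Num.sqrt).
  apply: continuous_big => [|i _ y]; first exact: add_continuous.
  have h := @coord_continuous R 1 d 0 i y; exact: (cvgM h h).
exact: sqrt_continuous.
Qed.

Lemma enormB_continuous x : continuous (fun y => enorm (y - x)).
Proof.
move=> y; apply: (@continuous_comp _ _ _ (fun y => y - x) (@enorm R d)).
  by apply: continuousB; [move=> ?|exact: cst_continuous].
exact: enorm_continuous.
Qed.

Lemma enorm_le_bounded r x : bounded_set [set y | enorm (y - x) <= r].
Proof.
exists (`|x| + r); split; first exact: num_real.
move=> M rM y /= yr; rewrite (le_trans _ (ltW rM)) // -[y](subrK x) addrC.
by rewrite (le_trans (ler_normD _ _)) // lerD2l (le_trans (norm_le_enorm _)).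
Qed.

Lemma enorm_le_compact r x : compact [set y | enorm (y - x) <= r].
Proof.
apply: bounded_closed_compact; first exact: enorm_le_bounded.
apply: (@preimage_closed _ _ (fun y => enorm (y - x)) [set s | s <= r]).
  by move=> y _; exact: enormB_continuous.
exact: closed_le.
Qed.

End EuclideanNorm.

(** * Directional derivatives in epsilon-delta form *)

Section DirectionalDerivative.
Context {R : realType} {V W : normedModType R}.
Implicit Types (f : V -> W) (x v : V) (l : W).

(** Free of division by [h], this form passes by mere inequalities to coordinates, inner products,
    the Euclidean norm and time slices. *)
Lemma is_deriveP f x v l : is_derive x v f l <->
  forall e : R, 0 < e -> exists2 r : R, 0 < r &
    forall h : R, `|h| < r -> `|f (x + h *: v) - f x - h *: l| <= e * `|h|.
Proof.
pose q (h : R) := h^-1 *: ((f \o shift x) (h *: v) - f x).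
have qE (h : R) : h != 0 ->
    `|f (x + h *: v) - f x - h *: l| = `|h| * `|l - q h|.
  move=> h0; rewrite distrC -normrZ scalerBr /q scalerA divff // scale1r /=.
  by rewrite (addrC x).
split=> [fl e e0|fl].
  have /cvgrPdist_le /(_ e e0) : q h @[h --> 0^'] --> l.
    by rewrite -(@derive_val _ _ _ _ _ _ _ fl); exact: (@ex_derive _ _ _ _ _ _ _ fl).
  move=> /nbhs_ballP[r /= r0 rq]; exists r => // h hr.
  have [->|h0] := eqVneq h 0; first by rewrite !scale0r addr0 !subrr !normr0 mulr0.
  rewrite qE // mulrC ler_wpM2r //; apply: rq => //.
  by rewrite /ball /= sub0r normrN.
have ql : q h @[h --> 0^'] --> l.
  apply/cvgrPdist_le => e /fl[r r0 rf]; apply/nbhs_ballP; exists r => //= h.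
  rewrite /ball /= sub0r normrN => /rf + h0.
  by rewrite qE // mulrC ler_pM2r // normr_gt0.
by split; [apply/cvg_ex; exists l|exact: cvg_lim].
Qed.

End DirectionalDerivative.

Lemma is_derive_line {R : realType} {V W : normedModType R} (f : V -> W) x v
    (s : R) l : is_derive (x + s *: v) v f l ->
  is_derive s (1 : R) (fun h : R => f (x + h *: v)) l.
Proof.
move=> /is_deriveP fl; apply/is_deriveP => e /fl[r r0 rf]; exists r => // h /rf.
by rewrite [h *: 1]mulr1 scalerDl addrA.
Qed.


(** * Entire solutions of the eikonal equation *)

Section Eikonal.
Context {R : realType} {d : nat}.
Implicit Types (u : 'rV[R]_d -> R) (g : 'rV[R]_d -> 'rV[R]_d) (x y : 'rV[R]_d).

Definition eikonal u g :=
  (forall x v, is_derive x v u (dotp (g x) v)) /\ (forall x, enorm (g x) = 1).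

Lemma eikonalN u g : eikonal u g -> eikonal (- u) (fun x => - g x).
Proof.
move=> [du g1]; split=> [x v|x]; last by rewrite enormN.
by rewrite dotpNl; exact: is_deriveN.
Qed.

(** Mean value theorem on the segment from [x] to [y], then Cauchy-Schwarz with a unit gradient. *)
Lemma eikonal_lipschitz u g x y : eikonal u g -> u y - u x <= enorm (y - x).
Proof.
move=> [du g1]; pose f (s : R) := u (x + s *: (y - x)).
have df (s : R) : is_derive s 1 f (dotp (g (x + s *: (y - x))) (y - x)).
  by apply: is_derive_line; exact: du.
have [|s _] := MVT_segment (f := f) ler01 (fun s _ => df s).
  by apply: derivable_within_continuous => s _; exact: ex_derive.
rewrite /f scale1r scale0r addr0 (addrC x) subrK subr0 mulr1 => ->.
by rewrite (le_trans (dotp_le _ _)) // g1 mul1r.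
Qed.

Lemma eikonal_continuous u g : eikonal u g -> continuous u.
Proof.
move=> ug x; apply: (@cvgrPdist_lt _ _ _ (nbhs x) (nbhs_filter x) _ _).2 => e e0.
have /cvgrPdist_lt /(_ _ e0) := @enormB_continuous _ _ x x.
apply: filterS => y; rewrite subrr enorm0 sub0r normrN ger0_norm ?enorm_ge0 //.
apply: le_lt_trans; rewrite ler_norml.
have := eikonal_lipschitz x y ug; have := eikonal_lipschitz y x ug.
by rewrite (enormB x y); lra.
Qed.

(* At an interior maximum of [u y - (1 - e) * enorm (y - x)] one could still
   climb along the gradient. *)
Lemma eikonal_ball_approx u g x (r e : R) : eikonal u g -> 0 <= r -> 0 < e < 1 ->
  exists2 y, enorm (y - x) <= r & u x + (1 - e) * r <= u y.
Proof.
move=> ug r0 /andP[e0 e1]; have [du g1] := ug.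
pose f y := u y - (1 - e) * enorm (y - x).
have cf : continuous f.
  move=> y; have h := @eikonal_continuous u g ug y; have h2 := @enormB_continuous R d x y.
  exact: (cvgB h (cvgM (cvg_cst _) h2)).
have [|y /set_mem/= yr ymax] := @compact_EVT_max _ _ f [set y | enorm (y - x) <= r] _ 
    (@enorm_le_compact R d r x) (continuous_subspaceT cf).
  by exists x; rewrite /= subrr enorm0.
exists y => //.
have := ymax x; rewrite inE /f /= subrr enorm0 mulr0 subr0 => /(_ r0) fx.
(* For a maximum on the sphere, [fx] is already the claim; only interior maxima remain to be
   excluded. *)
move: yr; rewrite le_eqVlt => /predU1P[<-|yr]; first lra.
have e20 : 0 < e / 2 by lra.
have /is_deriveP /(_ _ e20)[r' r'0 yr'] := du y (g y).
(* A step [h] along the gradient stays in the ball, gains at least [(1 - e / 2) * h] in [u] and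
   costs at most [(1 - e) * h], so [f] would increase. *)
pose h := Num.min (r' / 2) (r - enorm (y - x)).
have h0 : 0 < h by rewrite lt_min subr_gt0 yr andbT; lra.
have hr' : h < r' by rewrite gt_min ltr_pdivrMr //; apply/orP; left; lra.
have hr : h <= r - enorm (y - x) by rewrite ge_min lexx orbT.
have := yr' h; rewrite gtr0_norm // => /(_ hr').
rewrite -sqr_enorm g1 expr1n [h *: 1]mulr1 ler_norml => /andP[+ _].
have yh : enorm (y + h *: g y - x) <= enorm (y - x) + h.
  rewrite addrAC (le_trans (ler_enormD _ _)) // enormZ g1 mulr1 gtr0_norm //.
have := ymax (y + h *: g y).
rewrite inE /f /= => /(_ _) ymax'.
have := ymax' (le_trans yh _); nra.
Qed.

(** The maximum of [u] on the ball of radius [r] is [u x + r], and the Lipschitz bound puts it on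
    the sphere, at [x + r *: m] with [m] a unit vector. Then [u] has unit slope along this radius,
    which forces [m] to be the gradient at [x]. *)
Lemma eikonal_ray u g x (r : R) : eikonal u g -> 0 <= r ->
  u (x + r *: g x) = u x + r.
Proof.
move=> ug; have [du g1] := ug.
rewrite le_eqVlt => /predU1P[<-|r0]; first by rewrite scale0r !addr0.
have [|y /set_mem/= yr ymax] := @compact_EVT_max _ _ u [set y | enorm (y - x) <= r] _
    (@enorm_le_compact R d r x) (continuous_subspaceT (@eikonal_continuous u g ug)).
  by exists x; rewrite /= subrr enorm0 ltW.
have uy : u x + r <= u y.
  apply/ler_addgt0Pr => e e0.
  have er0 : 0 < e + r by rewrite addr_gt0.
  (* The relative loss [e / (e + r)] lies strictly between 0 and 1 and costs at most [e] over the
     radius [r]. *)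
  have [||z zr] := @eikonal_ball_approx u g x r (e / (e + r)) ug.
  - exact: ltW.
  - by rewrite divr_gt0 //= ltr_pdivrMr // mul1r ltrDl.
  have : u z <= u y by apply: ymax; rewrite inE.
  suff : e / (e + r) * r <= e by lra.
  by rewrite mulrAC -mulrA ler_piMr ?ltW // ltr_pdivrMr // mul1r ltrDr.
have yE : enorm (y - x) = r.
  by apply/eqP; rewrite eq_le yr /=; have := eikonal_lipschitz x y ug; lra.
have [m m1 yxm] : exists2 m, enorm m = 1 & y = x + r *: m.
  exists (r^-1 *: (y - x)).
    by rewrite enormZ yE gtr0_norm ?invr_gt0 // mulVf // gt_eqF.
  by rewrite scalerA divff ?gt_eqF // scale1r addrC subrK.
(* The Lipschitz bounds from [x] and from [y] squeeze [u] between equal values, the total growth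
   over the radius being [r]. *)
have um (s : R) : 0 <= s <= r -> u (x + s *: m) = u x + s.
  move=> /andP[s0 sr]; have := eikonal_lipschitz x (x + s *: m) ug.
  have := eikonal_lipschitz (x + s *: m) y ug.
  have -> : y - (x + s *: m) = (r - s) *: m.
    by rewrite {1}yxm opprD addrACA subrr add0r -scalerBl.
  rewrite (addrAC x) subrr add0r !enormZ m1 !mulr1 !ger0_norm ?subr_ge0 //.
  by move: uy; lra.
suff <- : m = g x by rewrite um // lexx ltW.
have gm : dotp (g x) m = 1.
  apply/eqP; rewrite -subr_eq0 -normr_le0; apply/ler_addgt0Pr => e e0; rewrite add0r.
  have /is_deriveP /(_ _ e0)[r' r'0 xr'] := du x m.
  pose h := Num.min (r' / 2) r.
  have h0 : 0 < h by rewrite lt_min r0 andbT; lra.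
  have hr' : h < r' by rewrite gt_min; apply/orP; left; lra.
  have hr : h <= r by rewrite ge_min lexx orbT.
  have := xr' h; rewrite gtr0_norm // => /(_ hr').
  rewrite um ?hr ?(ltW h0) // (addrAC (u x))
    subrr add0r -[X in X - _]mulr1 -mulrBr normrM.
  by rewrite gtr0_norm // mulrC ler_pM2r // distrC.
(* Equality in Cauchy-Schwarz for unit vectors: the squared norm of [m - g x] is 1 - 2 + 1. *)
apply/eqP; rewrite -subr_eq0; apply/eqP/enorm_eq0.
rewrite enormE !dotpE (dotpC m) gm -!sqr_enorm m1 g1.
by rewrite (_ : _ + _ = 0) ?sqrtr0 //; ring.
Qed.

(* [u] is 1-Lipschitz, so the points [x + r *: g x] with [r] large bound [u y]
   from below. *)
Lemma eikonal_ge u g x y : eikonal u g -> u x + dotp (g x) (y - x) <= u y.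
Proof.
move=> ug; have [_ g1] := ug.
set w := y - x; set D := u y - u x; set c := dotp (g x) w.
suff : c <= D by rewrite /D; lra.
rewrite leNgt; apply/negP => Dc.
have H (r : R) : 0 <= r -> r - D <= enorm (r *: g x - w).
  move=> r0; have := eikonal_lipschitz y (x + r *: g x) ug.
  have -> : r *: g x - w = x + r *: g x - y by rewrite /w opprB addrCA addrA.
  by rewrite eikonal_ray // /D; lra.
clearbody w D.
(* Squaring [H] gives [2 * r * (c - D) <= dotp w w - D ^+ 2]. This [r] makes [r - D] nonnegative, so
   that squaring is allowed, and [r * (c - D)] at least [dotp w w + 1], a contradiction. *)
pose r := `|D| + (dotp w w + 1) / (c - D).
have w0 := dotpxx_ge0 w.
have q0 : 0 < (dotp w w + 1) / (c - D) by rewrite divr_gt0; lra.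
have qE : (dotp w w + 1) / (c - D) * (c - D) = dotp w w + 1.
  by rewrite divfK // subr_eq0 gt_eqF.
have D1 := ler_norm D; have D0 := normr_ge0 D.
have r0 : 0 <= r by rewrite /r; lra.
have rD : 0 <= r - D by rewrite /r; lra.
have := H r r0; rewrite -ler_sqr ?nnegrE ?enorm_ge0 // sqr_enorm.
rewrite !dotpE (dotpC w) -/c -sqr_enorm g1.
have : r * (c - D) >= dotp w w + 1 by rewrite /r mulrDl qE lerDr mulr_ge0 //; lra.
by have := sqr_ge0 D; nra.
Qed.

(** The lower bound of [eikonal_ge] applied to [- u], again a solution, is the matching upper
    bound. *)
Lemma eikonal_affine u g x y : eikonal u g -> u y = u x + dotp (g x) (y - x).
Proof.
move=> ug; apply/eqP; rewrite eq_le eikonal_ge // andbT.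
have := eikonal_ge x y (eikonalN ug); rewrite dotpNl.
rewrite -[(- u) x]/(- u x) -[(- u) y]/(- u y); lra.
Qed.

End Eikonal.

(** * Lengths of curves and unit speed along strings *)

Lemma coord_le_norm {R : realType} {d : nat} (x : 'rV[R]_d) i : `|x 0 i| <= `|x|.
Proof.
by rewrite {2}/Num.norm /= mx_normrE; apply/bigmax_geP; right; exists (0, i).
Qed.

Lemma enorm_le_norm {R : realType} {d : nat} (x : 'rV[R]_d) :
  enorm x <= d%:R * `|x|.
Proof.
rewrite -ler_sqr ?nnegrE ?enorm_ge0 ?mulr_ge0 // sqr_enorm.
have xi i : x 0 i * x 0 i <= `|x| ^+ 2.
  by rewrite -expr2 -real_normK ?num_real // ler_sqr ?nnegrE // coord_le_norm.
apply: (@le_trans _ _ (d%:R * `|x| ^+ 2)).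
  by rewrite (le_trans (ler_sum _ (fun i _ => xi i))) // sumr_const card_ord mulr_natl.
rewrite exprMn ler_wpM2r ?sqr_ge0 // -natrX ler_nat -mulnn.
by case: (d) => // n; rewrite leq_pmulr.
Qed.

(** Induction on the subdivision: the Lipschitz bounds of successive chords telescope. *)
Lemma polygonal_length_le {R : realType} {d : nat} (g : R -> 'rV[R]_d)
    (a b c : R) s :
  (forall u v, a <= u -> u <= v -> v <= b -> enorm (g v - g u) <= c * (v - u)) ->
  itv_partition a b s -> polygonal_length a b g s <= c * (b - a).
Proof.
elim: s a => [|x s IH] a gc abs.
  by rewrite (itv_partition_nil abs) subrr mulr0 /polygonal_length big_geq.
have [ax xbs] : a < x /\ itv_partition x b s.
  by split; [case: abs => /= /andP[]|exact: itv_partition_cons abs].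
rewrite /polygonal_length /= big_nat_recl //= -/(polygonal_length x b g s).
have xb := itv_partition_le xbs.
have := IH x (fun u v xu => gc u v (le_trans (ltW ax) xu)) xbs.
by have := gc a x (lexx a) (ltW ax) xb; lra.
Qed.

Section UnitSpeed.
Context {R : realType} {d : nat}.
Implicit Types (f : R -> 'rV[R]_d).

Lemma is_derive_enorm f (s : R) l : is_derive s 1 f l ->
  forall e : R, 0 < e -> exists2 r : R, 0 < r &
    forall h, `|h| < r -> enorm (f (s + h) - f s - h *: l) <= e * `|h|.
Proof.
(* Dividing by [d.+1] rather than [d] covers dimension 0. *)
move=> /is_deriveP fl e e0; have e1 : 0 < e / d.+1%:R by rewrite divr_gt0.
have [r r0 fr] := fl _ e1; exists r => // h /fr.
rewrite [h *: 1]mulr1 => H; rewrite (le_trans (enorm_le_norm _)) //.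
rewrite (le_trans (ler_wpM2l _ H)) // mulrA ler_wpM2r // mulrCA ger_pMr //.
by rewrite ler_pdivrMr // mul1r ler_nat.
Qed.

Lemma is_derive_dotp f (s : R) l w : is_derive s 1 f l ->
  is_derive s 1 (fun s => dotp (f s) w) (dotp l w).
Proof.
move=> fl; apply/is_deriveP => e e0.
have e1 : 0 < e / (enorm w + 1) by rewrite divr_gt0 // ltr_wpDl // enorm_ge0.
have [r r0 fr] := is_derive_enorm fl e1; exists r => // h /fr fh.
have -> : dotp (f (s + h *: 1)) w - dotp (f s) w - h *: dotp l w =
    dotp (f (s + h) - f s - h *: l) w by rewrite !dotpE [h *: 1]mulr1.
rewrite (le_trans (norm_dotp_le _ _)) // (le_trans (ler_wpM2r (enorm_ge0 _) fh)) //.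
rewrite mulrAC ler_wpM2r // mulrAC -mulrA ler_piMr ?(ltW e0) //.
by rewrite ler_pdivrMr ?mul1r ?lerDl // ltr_wpDl // enorm_ge0.
Qed.

(** The scalar mean value theorem applies to the inner product of [f] with the displacement [w];
    Cauchy-Schwarz and division by [enorm w] give the bound. *)
Lemma enorm_mean_value f (df : R -> _) (a b c : R) : a <= b ->
  (forall s : R, is_derive s 1 f (df s)) ->
  (forall s, a <= s -> s <= b -> enorm (df s) <= c) ->
  enorm (f b - f a) <= c * (b - a).
Proof.
move=> ab fdf dfc; set w := f b - f a.
have [->|w0] := eqVneq (enorm w) 0.
  by rewrite mulr_ge0 ?subr_ge0 // (le_trans (enorm_ge0 (df a))) // dfc.
have wgt0 : 0 < enorm w by rewrite lt0r w0 enorm_ge0.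
pose g s := dotp (f s) w.
have dg (s : R) : is_derive s 1 g (dotp (df s) w) by exact: is_derive_dotp.
have [|s /andP[sa sb]] := MVT_segment (f := g) ab (fun s _ => dg s).
  by apply: derivable_within_continuous => s _; exact: ex_derive.
have -> : g b - g a = enorm w ^+ 2 by rewrite sqr_enorm {1}/w dotpDl dotpNl.
move=> wE; rewrite -(ler_pM2l wgt0) -expr2 wE mulrA ler_wpM2r ?subr_ge0 //.
by rewrite (le_trans (dotp_le _ _)) // mulrC ler_wpM2l ?enorm_ge0 // dfc.
Qed.

End UnitSpeed.

(** A chord is no longer than its arc, so the speed is at most 1. Conversely, by continuity the
    speed is below [enorm l + e] near 0, which bounds every polygonal length there, while the arc
    length equals the parameter length. *)
Lemma unit_speed {R : realType} {d : nat} (p : 'rV[R]_d -> 'rV[R]_d) L x v l :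
  (forall s, L (x + s *: v)) -> enorm v = 1 ->
  C1_on_string p L -> length_preserving_on p L ->
  is_derive (0 : R) 1 (fun s : R => p (x + s *: v)) l -> enorm l = 1.
Proof.
move=> Lv v1 pC pL; set f := fun s : R => _ => fl.
have chordE (h s : R) : chord x (x + h *: v) s = x + (s * h) *: v.
  by rewrite /chord (addrC x (h *: v)) addrK scalerA.
have pf : p \o chord x (x + 1 *: v) = f.
  by apply/funext => s /=; rewrite chordE mulr1.
have Lx : L x by have := Lv 0; rewrite scale0r addr0.
have [+ +] := pC _ _ Lx (Lv 1); rewrite pf => df cf.
have fdf (s : R) : is_derive s 1 f ((derive1 f) s).
  by rewrite derive1E; exact: derivableP.
have lE : l = (derive1 f) 0 by rewrite derive1E (@derive_val _ _ _ _ _ _ _ fl).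
have len (h : R) : 0 <= h -> path_length 0 1 (fun s => f (s * h)) = h%:E.
  move=> h0; have := pL _ _ Lx (Lv h).
  rewrite (addrC x) addrK enormZ v1 mulr1 ger0_norm // => <-; congr path_length.
  by apply/funext => s /=; rewrite addrC chordE.
apply/eqP; rewrite eq_le; apply/andP; split; apply/ler_addgt0Pr => e e0.
  have [r r0 fr] := is_derive_enorm fl e0.
  have h0 : 0 < r / 2 by lra.
  have := fr (r / 2); rewrite gtr0_norm // => /(_ _); rewrite add0r => fh.
  have fh1 : enorm (f (r / 2) - f 0) <= r / 2.
    (* The one-piece subdivision of the interval yields the chord. *)
    rewrite -lee_fin -(len _ (ltW h0)); apply: ereal_sup_ubound.
    exists [:: 1]; first exact: itv_partition1.
    by rewrite /polygonal_length big_nat1 /= mul1r mul0r.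
  have : enorm ((r / 2) *: l) <= (1 + e) * (r / 2).
    rewrite -[_ *: l](subKr (f (r / 2) - f 0)) (le_trans (ler_enormD _ _)) //.
    by rewrite mulrDl mul1r lerD // enormN fh //; lra.
  by rewrite enormZ gtr0_norm // mulrC ler_pM2r.
have /cvgrPdist_lt /(_ _ e0) : enorm ((derive1 f) s) @[s --> (0 : R)] --> enorm l.
  rewrite lE; apply: (@continuous_comp _ _ _ (derive1 f) (@enorm R d)).
    exact: cf.
  exact: enorm_continuous.
move=> /nbhs_ballP[r /= r0 fr].
have h0 : 0 < r / 2 by lra.
rewrite -(ler_pM2r h0) mul1r -lee_fin -(len _ (ltW h0)).
apply: ge_ereal_sup => _ [s s01 <-]; rewrite lee_fin.
suff : polygonal_length 0 1 (fun s => f (s * (r / 2))) s <=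
    (enorm l + e) * (r / 2) * (1 - 0).
  by rewrite subr0 mulr1.
apply: polygonal_length_le s01.
move=> a b a0 ab b1; rewrite -(mulrA _ (r / 2)) (mulrC (r / 2)) mulrBl.
apply: (@enorm_mean_value _ _ f (derive1 f)) => //; first by rewrite ler_pM2r.
move=> u ua ub.
have a1 : 0 <= a * (r / 2) by rewrite mulr_ge0 // ltW.
have b2 : b * (r / 2) <= 1 * (r / 2) by rewrite ler_pM2r.
have := fr u; rewrite /ball /= sub0r normrN ger0_norm; last lra.
by move=> /(_ ltac:(lra)); rewrite ltr_distlC => /andP[_ /ltW].
Qed.

(** * From a pointwise orthogonal derivative to a global isometry *)

Lemma dotp_mulmx {R : realType} {d : nat} (x y : 'rV[R]_d) :
  dotp x y = (x *m y^T) 0 0.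
Proof. by rewrite mxE; apply: eq_bigr => i _; rewrite mxE. Qed.

(** The gradient of the [i]-th coordinate of [f] is the [i]-th column of [M x], a unit vector. So
    every coordinate is affine, and [f] is affine with the orthogonal linear part [M y]. *)
Lemma orthogonal_derivative_isometry {R : realType} {d : nat}
    (f : 'rV[R]_d -> 'rV[R]_d) (M : 'rV[R]_d -> 'M[R]_d) :
  (forall x v, is_derive x v f (v *m M x)) ->
  (forall x, M x *m (M x)^T = 1%:M) -> euclidean_isometry f.
Proof.
move=> fM MM x y.
have fi i : eikonal (fun x => f x 0 i) (fun x => (col i (M x))^T).
  split=> z => [v|].
    have -> : dotp (col i (M z))^T v = (v *m M z) 0 i.
      by rewrite mxE; apply: eq_bigr => j _; rewrite !mxE mulrC.
    apply/is_deriveP => e e0.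
    have /is_deriveP /(_ _ e0)[r r0 fr] := fM z v; exists r => // h /fr.
    apply: le_trans; have := coord_le_norm (f (z + h *: v) - f z - h *: (v *m M z)) i.
    by rewrite !mxE.
  rewrite enormE (_ : dotp _ _ = ((M z)^T *m M z) i i).
    (* Orthonormal rows are given, but the gradients are columns, hence the passage to the product
       in the other order. *)
    by rewrite (mulmx1C (MM z)) mxE eqxx sqrtr1.
  by rewrite mxE; apply: eq_bigr => j _; rewrite !mxE.
have -> : f x - f y = (x - y) *m M y.
  apply/rowP => i; rewrite !mxE (eikonal_affine y x (fi i)) addrAC subrr add0r.
  by apply: eq_bigr => j _; rewrite !mxE mulrC.
by rewrite !enormE !dotp_mulmx trmx_mul mulmxA -(mulmxA (x - y)) MM mulmx1.
Qed.

(** * The three string directions and the density of strings in each *)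

Section KagomeDirections.
Context {R : realType}.

Definition vec2 (a b : R) : 'rV[R]_2 := \row_j (if j == 0 then a else b).

Lemma ord2 (i : 'I_2) : i = 0 \/ i = 1.
Proof. by case: i => [[|[|//]] ?]; [left|right]; exact: val_inj. Qed.

Lemma sum2 (F : 'I_2 -> R) : \sum_i F i = F 0 + F 1.
Proof. by rewrite big_ord_recl big_ord1; congr (_ + F _); exact: val_inj. Qed.

(** The hypotheses are values of the quadratic form of [M *m M^T]. The first is the squared norm of
    the first row; the difference of the other two isolates the inner product of the rows, and their
    sum the norm of the second row. *)
Lemma orthogonal_three_directions (M : 'M[R]_2) :
  enorm (vec2 1 0 *m M) = 1 ->
  enorm (vec2 2^-1 (Num.sqrt 3 / 2) *m M) = 1 ->
  enorm (vec2 (- 2^-1) (Num.sqrt 3 / 2) *m M) = 1 -> M *m M^T = 1%:M.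
Proof.
set s := Num.sqrt 3.
have ss : s ^+ 2 = 3 by rewrite sqr_sqrtr.
have s0 : 0 < s by rewrite sqrtr_gt0.
have E (a b : R) : enorm (vec2 a b *m M) = 1 ->
    (a * M 0 0 + b * M 1 0) ^+ 2 + (a * M 0 1 + b * M 1 1) ^+ 2 = 1.
  move=> /(congr1 (fun r => r ^+ 2)); rewrite sqr_enorm expr1n => <-.
  by rewrite /dotp !sum2 !mxE !sum2 !mxE /= !expr2.
move=> /E h1 /E h2 /E h3.
have ab : M 0 0 * M 1 0 + M 0 1 * M 1 1 = 0.
  have /eqP : s * (M 0 0 * M 1 0 + M 0 1 * M 1 1) = 0 by lra.
  by rewrite mulf_eq0 gt_eqF //= => /eqP.
have bb : M 1 0 ^+ 2 + M 1 1 ^+ 2 = 1.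
  by have := congr1 ( *%R^~ (M 1 0 ^+ 2 + M 1 1 ^+ 2)) ss; rewrite /=; lra.
apply/matrixP => i j; rewrite !mxE sum2 !mxE.
case: (ord2 i) => ->; case: (ord2 j) => -> /=; lra.
Qed.

(** Scaling by [3 ^- n] shrinks the spacing [c] of the progression below [e]. *)
Lemma triadic_approx (tau c b e : R) : 0 < c -> 0 < e ->
  exists n (k : int), (1 <= n)%N /\ `|3 ^- n * (c * k%:~R + b) - tau| < e.
Proof.
move=> c0 e0.
have [n ne] : exists n : nat, c / e < 3 ^+ n.+1.
  have ce0 : 0 <= c / e by rewrite divr_ge0 ?ltW.
  exists (Num.truncn (c / e)); have /andP[_ lt] := truncn_itv ce0.
  rewrite (lt_trans lt) // -natrX ltr_nat ltn_expl //.
have n0 : 0 < 3 ^+ n.+1 :> R by rewrite exprn_gt0.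
(* The successor meets the requirement that scales start at 1; the floor is taken of the exact real
   solution of the equation for [k], at a cost of at most one spacing. *)
exists n.+1, (Num.floor ((3 ^+ n.+1 * tau - b) / c)); split=> //.
set q := _ / c; have /andP[q1 q2] := floor_itv q.
rewrite -(ltr_pM2l n0) -[X in X * `|_|]gtr0_norm // -normrM.
rewrite mulrBr mulrA divff ?gt_eqF // mul1r.
have qE : 3 ^+ n.+1 * tau = c * q + b by rewrite /q mulrCA divff ?gt_eqF // mulr1 subrK.
rewrite qE opprD addrACA subrr addr0 -mulrBr normrM gtr0_norm //.
have : `|(Num.floor q)%:~R - q| <= 1.
  by move: q2; rewrite intrD ler_norml; lra.
rewrite -(ler_pM2l c0) mulr1 => /le_lt_trans; apply.
by rewrite -ltr_pdivrMr.
Qed.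

(* [c * k%:~R + b] is the intercept of the string [K k], measured along [w], and
   [tau z] that of the line through [z] parallel to the strings. *)
Lemma string_dense (K : int -> set 'rV[R]_2) (tau : 'rV[R]_2 -> R) (v w : 'rV[R]_2)
    (c b : R) :
  (forall k, kagome_strings (K k)) ->
  (forall k z s, K k z -> K k (z + s *: v)) ->
  (forall a z, tau (a *: z) = a * tau z) -> `|w| <= 1 -> 0 < c ->
  (forall k z, K k (z + (c * k%:~R + b - tau z) *: w)) ->
  forall x e, 0 < e -> exists y L, [/\ ball x e y,
    strings (triadic_kagome_mesh R) L & forall s, L (y + s *: v)].
Proof.
move=> KS Kv tauZ w1 c0 Kw x e e0.
have [n [k [n1 nk]]] := triadic_approx (tau x) b c0 e0.
have n0 : (3 : R) ^+ n != 0 by rewrite expf_neq0.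
(* [x] is shifted along [w] until its intercept is that of the rescaled string. *)
exists (x + (3 ^- n * (c * k%:~R + b) - tau x) *: w).
exists [set 3 ^- n *: z | z in K k]; split.
- rewrite -ball_normE /= opprD addrA subrr add0r normrN normrZ.
  by rewrite (le_lt_trans _ nk) // ler_piMr.
- by exists n => //; exists (K k) => //; exact: KS.
- move=> s; pose z := 3 ^+ n *: x.
  exists (z + (c * k%:~R + b - tau z) *: w + (3 ^+ n * s) *: v).
    exact/Kv/Kw.
  rewrite !scalerDr !scalerA mulKf // mulVf // scale1r; congr (_ + _ *: _ + _).
  by rewrite tauZ mulrBr mulKf.
Qed.

End KagomeDirections.

Section KagomeDense.
Context {R : realType}.
Local Notation sqrt3 := (Num.sqrt 3 : R).

(** Unit vectors at angles 0, 60 and 120 degrees. *)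
Definition kagome_direction (v : 'rV[R]_2) :=
  [\/ v = vec2 1 0, v = vec2 2^-1 (sqrt3 / 2) | v = vec2 (- 2^-1) (sqrt3 / 2)].

Lemma kagome_direction_unit v : kagome_direction v -> enorm v = 1.
Proof.
have s3 : sqrt3 ^+ 2 = 3 by rewrite sqr_sqrtr.
move=> vk; rewrite enormE /dotp sum2 (_ : _ + _ = 1) ?sqrtr1 //.
case: vk => -> ; rewrite !mxE /=; lra.
Qed.

Lemma vec2_norm_le1 (a b : R) : `|a| <= 1 -> `|b| <= 1 -> `|vec2 a b| <= 1.
Proof.
move=> a1 b1; rewrite {1}/Num.norm /= mx_normrE; apply/bigmax_leP; split=> // -[i j] _ /=.
by rewrite mxE; case: ifP.
Qed.

(** Intercepts are read on the y-axis for horizontal strings, with spacing [sqrt3], and on the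
    x-axis for oblique ones, with spacing 2 and offset 0 or 1. *)
Lemma kagome_direction_dense v x (e : R) : kagome_direction v -> 0 < e ->
  exists y L, [/\ ball x e y,
    strings (triadic_kagome_mesh R) L & forall s, L (y + s *: v)].
Proof.
have s0 : 0 < sqrt3 by rewrite sqrtr_gt0.
have sN : sqrt3 != 0 by rewrite gt_eqF.
move=> + e0; case=> ->.
- apply: (@string_dense _ (@kagome_horizontal R) (fun z => z 0 1) _
    (vec2 0 1) sqrt3 0) => //.
  + by move=> k; left; left; exists k.
  + by move=> k z s; rewrite /kagome_horizontal /= !mxE /= mulr0 addr0.
  + by move=> a z; rewrite !mxE.
  + by apply: vec2_norm_le1; rewrite ?normr0 ?normr1.
  + by move=> k z; rewrite /kagome_horizontal /= !mxE /=; ring.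
- apply: (@string_dense _ (@kagome_up R) (fun z => z 0 0 - z 0 1 / sqrt3) _
    (vec2 1 0) 2 0) => //.
  + by move=> k; left; right; exists k.
  + by move=> k z s; rewrite /kagome_up /= !mxE /= => ->; field.
  + by move=> a z; rewrite !mxE mulrBr mulrA.
  + by apply: vec2_norm_le1; rewrite ?normr0 ?normr1.
  + by move=> k z; rewrite /kagome_up /= !mxE /= intrM; field.
- apply: (@string_dense _ (@kagome_down R) (fun z => z 0 0 + z 0 1 / sqrt3) _
    (vec2 1 0) 2 1) => //.
  + by move=> k; right; exists k.
  + by move=> k z s; rewrite /kagome_down /= !mxE /= => ->; field.
  + by move=> a z; rewrite !mxE mulrDr mulrA.
  + by apply: vec2_norm_le1; rewrite ?normr0 ?normr1.
  + by move=> k z; rewrite /kagome_down /= !mxE /= intrD intrM; field.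
Qed.

Lemma closure_body_triadic_kagome : closure (body (triadic_kagome_mesh R)) = setT.
Proof.
apply/seteqP; split=> // x _ B /nbhs_ballP[e /= e0 eB].
have v : kagome_direction (vec2 1 0) by constructor 1.
have [y [L [xy LK Ly]]] := kagome_direction_dense x v e0.
exists y; split; last exact: eB.
by exists L => //; have := Ly 0; rewrite scale0r addr0.
Qed.

End KagomeDense.

(** * Freezing the time variable of a relatively C1 map *)

Section Slice.
Context {R : realType} {V W : normedModType R}.

Definition inj_left (v : V) : V * W := (v, 0).

Lemma inj_left_linear : linear inj_left.
Proof. by move=> a u v; congr (_, _); rewrite /= scaler0 addr0. Qed.

HB.instance Definition _ := GRing.isLinear.Build R V (V * W)%type *:%R
  inj_left inj_left_linear.

(** Balls of the product contain balls of the slice at time [t], even when [t] is an endpoint of the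
    time interval. *)
Lemma near_slice (J : set W) (t : W) (x : V) (Q : V * W -> Prop) : J t ->
  (\forall z \near within (setT `*` J) (nbhs (x, t)), Q z) ->
  \forall y \near x, Q (y, t).
Proof.
move=> It /nbhs_ballP[e /= e0 eQ]; apply/nbhs_ballP; exists e => // y xy.
by apply: eQ; split=> //=; exact: ballxx.
Qed.

End Slice.

(** The derivative of the slice is the full derivative composed with [v] mapped to [(v, 0)]; moving
    inside the slice never leaves the set of differentiability. *)
Lemma C1_on_slice {R : realType} {V W E : normedModType R} (J : set W) (t : W)
    (P : V * W -> E) (C1P : C1_on (setT `*` J) P) : J t ->
  exists D : V -> {linear V -> E},
    (forall x v, is_derive x v (fun y => P (y, t)) (D x v)) /\
    (forall v, continuous (fun x => D x v)).
Proof.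
move=> It; have [df [Pdf dfc]] := C1P.
exists (fun x => (df (x, t) \o inj_left : {linear V -> E})); split=> [x v|v x].
  have /funext /eqaddoP Px := Pdf (x, t) (conj I It).
  apply/is_deriveP => e e0.
  (* Adding 1 to the norm keeps the divisor positive when [v] is 0. *)
  have e1 : 0 < e / (`|v| + 1) by rewrite divr_gt0 // ltr_wpDl.
  have /nbhs_ballP[r /= r0 rP] := near_slice It (Px _ e1).
  have r1 : 0 < r / (`|v| + 1) by rewrite divr_gt0 // ltr_wpDl.
  exists (r / (`|v| + 1)) => // h hr.
  have v0 : 0 < `|v| + 1 by rewrite ltr_wpDl.
  have hv : `|h *: v| < r.
    rewrite normrZ; apply: (le_lt_trans _ (_ : `|h| * (`|v| + 1) < r)).
      by rewrite ler_wpM2l // lerDl.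
    by rewrite -ltr_pdivlMr.
  have := rP (x + h *: v); rewrite -ball_normE /= opprD addNKr normrN => /(_ hv).
  rewrite -[(P - _) _]/(P (x + h *: v, t) -
    (P (x, t) + df (x, t) ((x + h *: v, t) - (x, t)))).
  have -> : (x + h *: v, t) - (x, t) = inj_left (h *: v).
    by congr (_, _); rewrite /= ?subrr // addrAC subrr add0r.
  rewrite !linearZ /= opprD addrA normrZ => H; rewrite scalerN.
  have lv : `|inj_left v : V * W| = `|v| by rewrite prod_normE /= normr0 max_l.
  rewrite (le_trans H) // lv mulrCA mulrC ler_wpM2r // mulrAC -mulrA.
  by rewrite ler_piMr ?(ltW e0) // ler_pdivrMr // mul1r lerDl.
have /subspace_continuousP /(_ (x, t) (conj I It)) /cvgrPdist_lt H := dfc (inj_left v).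
apply/cvgrPdist_lt => e /H; exact: near_slice.
Qed.

Theorem theorem5p6 (R : realType) (p : R -> 'rV[R]_2 -> 'rV[R]_2) :
  uniformly_C1_flex (triadic_kagome_mesh R) p ->
  forall t : R, t \in `[0, 1] ->
    exists T : 'rV[R]_2 -> 'rV[R]_2,
      euclidean_isometry T /\
      forall x, body (triadic_kagome_mesh R) x -> p t x = T x.
Proof.
move=> [[pl _ _] [P [Pp C1P]]] t t01.
exists (fun x => P (x, t)); split; last by move=> x xK; rewrite Pp.
rewrite closure_body_triadic_kagome interiorT in C1P.
have [D [PD Dc]] := C1_on_slice C1P t01.
have [_ pC pL] := pl t t01.
(* At points of strings directed by [v] this is [unit_speed]; such points are dense and [D] is
   continuous, so the norm at [x] is within every [e] of 1. *)
have D1 x v : kagome_direction v -> enorm (D x v) = 1.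
  move=> vk; apply/eqP; rewrite -subr_eq0 -normr_le0.
  apply/ler_addgt0Pr => e e0; rewrite add0r.
  have /cvgrPdist_lt /(_ _ e0) : enorm (D y v) @[y --> x] --> enorm (D x v).
    apply: (@continuous_comp _ _ _ (fun y => D y v) (@enorm R 2)).
      exact: Dc.
    exact: enorm_continuous.
  move=> /nbhs_ballP[r /= r0 xr].
  have [y [L [xy LK Ly]]] := kagome_direction_dense x vk r0.
  suff <- : enorm (D y v) = 1 by exact/ltW/xr.
  apply: (unit_speed Ly (kagome_direction_unit vk) (pC L LK) (pL L LK)).
  have -> : (fun s : R => p t (y + s *: v)) = (fun s => P (y + s *: v, t)).
    by apply/funext => s; rewrite Pp //; exists L.
  apply: (@is_derive_line _ _ _ (fun z => P (z, t))).
  by rewrite scale0r addr0.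
(* [lin1_mx] is the matrix acting on row vectors from the right, as [orthogonal_derivative_isometry]
   expects. *)
apply: (@orthogonal_derivative_isometry _ _ _ (fun x => lin1_mx (D x))) => x.
  by move=> v; rewrite mul_rV_lin1.
by apply: orthogonal_three_directions; rewrite mul_rV_lin1 D1 //;
  [constructor 1|constructor 2|constructor 3].
Qed.
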